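(* Let $G$ be a finite simple undirected graph on the vertex set $\{1,\ldots,n\}$ with at least one edge, let $A$ be its adjacency matrix, let $\chi$ be its chromatic number and $\xi'$ its normalized orthogonal rank. Then $\xi'\le\chi$, and for every self-adjoint complex $n\times n$ matrix $W$ with $W*A\neq0$ (in particular for the all-one matrix $W=J$, for which $W*A=A$) one has $$\xi'\;\ge\;1+\max_{m=1,\ldots,n-1}\left\{\frac{\sum_{i=1}^m \mu_i(W*A)}{-\sum_{i=1}^m \mu_{n-i+1}(W*A)}\right\}\qquad\text{and}\qquad \xi'\;\ge\;\frac{S^+(W*A)}{S^-(W*A)}.$$ Here $\mu_1(W*A)\ge\cdots\ge\mu_n(W*A)$ are the eigenvalues of $W*A$ counted with multiplicity, and $S^+(W*A)$ and $S^-(W*A)$ are the sums of the squares of the positive and of the negative eigenvalues of $W*A$, respectively.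
   Context: The adjacency matrix of $G$ is the $n\times n$ matrix $A=(a_{k\ell})$ with $a_{k\ell}=1$ if $(k,\ell)$ is an edge and $a_{k\ell}=0$ otherwise. The Schur product $W*A$ is the entrywise product, $(W*A)_{k\ell}=w_{k\ell}a_{k\ell}$. The chromatic number $\chi$ is the least $c$ for which there is a map $\Phi:\{1,\ldots,n\}\to\{1,\ldots,c\}$ with $\Phi(k)\ne\Phi(\ell)$ whenever $a_{k\ell}=1$. A $d$-dimensional orthogonal representation of $G$ is a map $\Psi:\{1,\ldots,n\}\to\mathbb{C}^d$ (column vectors) such that $a_{k\ell}=1$ implies $\Psi(k)^\dagger\Psi(\ell)=0$, where $\dagger$ denotes conjugate transpose. It is normalized if every entry of every vector $\Psi(k)$ has modulus one. The normalized orthogonal rank $\xi'$ is the smallest $d$ such that $G$ has a normalized orthogonal representation in $\mathbb{C}^d$. *)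

(* Defs.v *)
From mathcomp Require Import all_boot all_order all_algebra.
From mathcomp Require Import boolp reals.
From mathcomp.real_closed Require Import complex.

Set Implicit Arguments.
Unset Strict Implicit.
Unset Printing Implicit Defensive.
Import Order.TTheory GRing.Theory Num.Theory.
Local Open Scope ring_scope.
Local Open Scope sesquilinear_scope.

(* Graphs on n vertices are given by an adjacency relation [e : rel 'I_n];
   the vertices are numbered from 0. *)

Definition adjmx (R : realType) (n : nat) (e : rel 'I_n) : 'M[R[i]]_n :=
  \matrix_(k, l) (e k l)%:R.

Definition schurmx (R : realType) (n : nat) (W A : 'M[R[i]]_n) : 'M[R[i]]_n :=
  map2_mx *%R W A.

Definition colorable (n : nat) (e : rel 'I_n) (c : nat) : bool :=
  [exists f : {ffun 'I_n -> 'I_c}, forall k, forall l, e k l ==> (f k != f l)].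

Lemma colorable_exists (n : nat) (e : rel 'I_n) :
  irreflexive e -> exists c, colorable e c.
Proof.
move=> eI; exists n; apply/existsP; exists [ffun k => k].
apply/forallP => k; apply/forallP => l; apply/implyP; rewrite !ffunE.
by apply: contraTneq => ->; rewrite eI.
Qed.

Definition chromatic_number (n : nat) (e : rel 'I_n) (eI : irreflexive e) : nat :=
  ex_minn (colorable_exists eI).

Definition orth_rep (R : realType) (n : nat) (e : rel 'I_n) (d : nat)
    (Psi : 'I_n -> 'cV[R[i]]_d) : Prop :=
  forall k l, e k l -> (Psi k)^t* *m Psi l = 0.

Definition normalized (R : realType) (n d : nat)
    (Psi : 'I_n -> 'cV[R[i]]_d) : Prop :=
  forall k (j : 'I_d), `|Psi k j 0| = 1.

(* Dimension 0 has to be excluded: both conditions are vacuous in C^0. *)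
Definition has_norm_orth_rep (R : realType) (n : nat) (e : rel 'I_n) (d : nat) :
    bool :=
  (0 < d)%N &&
  `[< exists Psi : 'I_n -> 'cV[R[i]]_d, orth_rep e Psi /\ normalized Psi >].

(* The rows of the 2^n x 2^n Sylvester-Hadamard matrix indexed by the n
   singletons. *)
Lemma norm_orth_rep_exists (R : realType) (n : nat) (e : rel 'I_n) :
  irreflexive e -> exists d, has_norm_orth_rep R e d.
Proof.
move=> eI; exists #|{set 'I_n}|; apply/andP; split.
  by apply/card_gt0P; exists set0.
apply/asboolP.
exists (fun k => \col_j (-1) ^+ (k \in (enum_val j : {set 'I_n}))); split; last first.
  by move=> k j; rewrite mxE normrX normrN1 expr1n.
move=> k l ekl; have kNl : l != k by apply: contraTneq ekl => ->; rewrite eI.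
apply/matrixP => i j; rewrite !mxE.
pose h (T : {set 'I_n}) : R[i] := (-1) ^+ (k \in T) * (-1) ^+ (l \in T).
rewrite (eq_bigr (fun t => h (enum_val t))); last first.
  by move=> t _; rewrite !mxE rmorphXn rmorphN rmorph1.
rewrite -(big_enum_val (A := {set 'I_n}) h).
pose g (T : {set 'I_n}) := if k \in T then T :\ k else k |: T.
have gK : involutive g.
  move=> T; rewrite /g; case: (boolP (k \in T)) => kT.
    by rewrite setD11 setD1K.
  by rewrite setU11 setU1K.
have hg T : h (g T) = - h T.
  rewrite /h /g; case: ifP => kT; rewrite !inE eqxx (negPf kNl) /=.
    by rewrite mulNr !mul1r opprK.
  by rewrite mulN1r mul1r.
set S := \sum_(T in _) _; have SN : S = - S.
  by rewrite {1}/S (reindex_inj (inv_inj gK)) -sumrN; apply: eq_bigr.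
by apply/eqP; move/eqP: SN; rewrite -addr_eq0 -mulr2n mulrn_eq0.
Qed.

Definition norm_orth_rank (R : realType) (n : nat) (e : rel 'I_n)
    (eI : irreflexive e) : nat :=
  ex_minn (norm_orth_rep_exists R eI).

(* The roots of the characteristic polynomial, repeated according to their
   multiplicity, in an unspecified order. *)
Definition char_roots (R : realType) (n : nat) (M : 'M[R[i]]_n) : seq R[i] :=
  sval (closed_field_poly_normal (char_poly M)).

(* Only meant for a self-adjoint M, whose eigenvalues are real. *)
Definition eigvals (R : realType) (n : nat) (M : 'M[R[i]]_n) : seq R :=
  sort >=%R [seq complex.Re z | z <- char_roots M].

(* The i-th largest eigenvalue, counted from i = 1. *)
Definition mu (R : realType) (n : nat) (M : 'M[R[i]]_n) (i : nat) : R :=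
  nth 0 (eigvals M) i.-1.

Definition eig_ratio (R : realType) (n : nat) (M : 'M[R[i]]_n) (m : nat) : R :=
  (\sum_(1 <= i < m.+1) mu M i) / (- \sum_(1 <= i < m.+1) mu M (n - i + 1)).

(* The maximum over 1 <= m <= n - 1; this range is nonempty as soon as n >= 2,
   and then contains the seed m = 1. *)
Definition max_eig_ratio (R : realType) (n : nat) (M : 'M[R[i]]_n) : R :=
  \big[Num.max/eig_ratio M 1]_(1 <= m < n) eig_ratio M m.

Definition Splus (R : realType) (n : nat) (M : 'M[R[i]]_n) : R :=
  \sum_(x <- eigvals M | 0 < x) x ^+ 2.

Definition Sminus (R : realType) (n : nat) (M : 'M[R[i]]_n) : R :=
  \sum_(x <- eigvals M | x < 0) x ^+ 2.

(* Main.v *)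
Require Import Defs.
From mathcomp Require Import all_boot all_order all_algebra all_fingroup.
From mathcomp Require Import cyclic separable cyclotomic.
From mathcomp Require Import boolp reals.
From mathcomp.real_closed Require Import complex.
From mathcomp Require Import zify ring lra.

Set Implicit Arguments.
Unset Strict Implicit.
Unset Printing Implicit Defensive.
Import Order.TTheory GRing.Theory Num.Theory.
Local Open Scope ring_scope.
Local Open Scope sesquilinear_scope.

(** Fix a normalized orthogonal representation Psi in dimension d, let
    D_j = diag (Psi(1)_j, ..., Psi(n)_j), and let M be a self-adjoint matrix
    vanishing off the edges.  The (k, l) entry of the sum over j of
    D_j^* M D_j is M_kl times the inner product of Psi(k) and Psi(l), so this
    sum is 0, while normalization makes every D_j unitary: d unitary conjugates
    of M cancel out.

    Let U diagonalize M, with eigenvalues lam, and put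
    Q_ij = U D_i D_j^* U^*.  Conjugating the relation by U D_i and reading the
    diagonal entries turns it into real linear relations between the
    eigenvalues: the matrices S_ij = (|Q_ij(a, b)|^2) are doubly stochastic,
    S_ii is the identity, S_ji is the transpose of S_ij, and for each i the sum
    over j of S_ij lam is 0 ([orth_rep_bistochastic]).  Both spectral bounds
    use only this.

    For the first bound ([top_sum_le_bottom]), the relation for one i
    reads lam = - (sum over j <> i of S_ij lam).  Summing over the m largest
    eigenvalues, each of the d - 1 terms on the right contributes at least the
    sum of the m smallest eigenvalues; this is the Ky Fan inequality in doubly
    stochastic form ([bistochastic_sum_ge]).

    For the second bound ([positive_squares_le]), write lam = p - q with p and
    q the positive and negative parts, and let F(x, y) be the sum over all i
    and j of x^T S_ij y.  The relations give F(x, p) = F(x, q) for all x, and F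
    is symmetric, so F(p, p) = F(q, q).  The d diagonal terms of F(p, p) give
    d S^+ <= F(p, p), and each of the d^2 terms of F(q, q) is at most S^-.

    Finally, a colouring f with c colours gives the normalized orthogonal
    representation Psi(k)_j = w^(f(k) j), where w is a primitive c-th root of
    unity, whence the comparison with the chromatic number. *)

(** * Colourings and roots of unity *)

Lemma prim_root_exists (F : numClosedFieldType) (c : nat) :
  (0 < c)%N -> exists w : F, c.-primitive_root w.
Proof.
move=> c0; have [r Dr] := closed_field_poly_normal ('X^c - 1 : {poly F}).
rewrite (monicP _) ?monicXnsubC // scale1r in Dr.
have /hasP[w _ prim_w] : has c.-primitive_root r; last by exists w.
apply: has_prim_root => //.
- by apply/allP => z; rewrite -root_prod_XsubC -Dr.
- by rewrite -separable_prod_XsubC -Dr separable_Xn_sub_1 // pnatr_eq0 -lt0n.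
- by rewrite -ltnS -(size_prod_XsubC r id) -Dr size_XnsubC.
Qed.

Lemma norm_unity_root (F : numClosedFieldType) (c : nat) (z : F) :
  (0 < c)%N -> z ^+ c = 1 -> `|z| = 1.
Proof.
move=> c0 zc; apply/eqP; rewrite -(@pexpr_eq1 _ _ c) //.
by rewrite -normrX zc normr1.
Qed.

Lemma sum_unity_root (F : fieldType) (c : nat) (z : F) :
  z ^+ c = 1 -> z != 1 -> \sum_(j < c) z ^+ j = 0.
Proof.
move=> zc z1; apply/eqP; have /eqP := subrX1 z c.
by rewrite zc subrr eq_sym mulf_eq0 subr_eq0 (negPf z1).
Qed.

Lemma colorable_norm_orth_rep (R : realType) (n : nat) (e : rel 'I_n)
    (c : nat) :
  (0 < c)%N -> colorable e c -> has_norm_orth_rep R e c.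
Proof.
move=> c0 /existsP[f /forallP fP]; rewrite /has_norm_orth_rep c0 /=.
have [w wP] := prim_root_exists R[i] c0; have wc := prim_expr_order wP.
have nw : `|w| = 1 := norm_unity_root c0 wc.
apply/asboolP; exists (fun k => \col_j w ^+ (f k * j)); split; last first.
  by move=> k j; rewrite mxE normrX nw expr1n.
move=> k l ekl; apply/matrixP => i j; rewrite !mxE.
under eq_bigr => a _ do rewrite !mxE !exprM rmorphXn -exprMn.
have ww : w^* * w = 1 by rewrite -normCKC nw expr1n.
apply: sum_unity_root.
  by rewrite exprMn -rmorphXn -!exprM !(mulnC _ c) !exprM wc !expr1n rmorph1 mulr1.
apply/eqP => h; have /eqP : w ^+ f l = w ^+ f k.
  rewrite -[RHS]mulr1 -h mulrA rmorphXn [w ^+ f k * _]mulrC -exprMn ww expr1n.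
  by rewrite mul1r.
rewrite (eq_prim_root_expr wP) !modn_small // => /eqP/val_inj flk.
by have /forallP/(_ l)/implyP/(_ ekl) := fP k; rewrite flk eqxx.
Qed.

Lemma norm_orth_rank_le_chromatic (R : realType) (n : nat) (e : rel 'I_n)
    (eI : irreflexive e) :
  (0 < n)%N -> (norm_orth_rank R eI <= chromatic_number eI)%N.
Proof.
move=> n0; rewrite /norm_orth_rank /chromatic_number.
case: ex_minnP => d _ dmin; case: ex_minnP => c cP _; apply: dmin.
apply: colorable_norm_orth_rep => //; case/existsP: cP => f _.
exact: leq_ltn_trans (leq0n _) (ltn_ord (f (Ordinal n0))).
Qed.

(** * Diagonalization by the sorted spectrum *)

Lemma char_poly_unitary_similar (F : numClosedFieldType) (n : nat)
    (U M : 'M[F]_n) :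
  U \is unitarymx -> char_poly (U *m M *m U^t*) = char_poly M.
Proof.
move=> Uu; rewrite /char_poly /char_poly_mx.
have UU : map_mx polyC U *m map_mx polyC (U^t*) = 1%:M.
  by rewrite -map_mxM (unitarymxP Uu) map_scalar_mx.
have -> : 'X%:M - map_mx polyC (U *m M *m U^t*) =
    map_mx polyC U *m ('X%:M - map_mx polyC M) *m map_mx polyC (U^t*).
  rewrite mulmxBr mulmxBl [in RHS]scalar_mxC -(mulmxA 'X%:M) UU mulmx1.
  by rewrite !map_mxM.
by rewrite !det_mulmx mulrAC -det_mulmx UU det1 mul1r.
Qed.

(** The spectral theorem with the eigenvalues in decreasing order: the
    diagonal of any unitary diagonalization lists the roots of the
    characteristic polynomial, and sorting it permutes the rows of the
    unitary matrix. *)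
Lemma hermitian_eigvals (R : realType) (n : nat) (M : 'M[R[i]]_n) :
  M \is hermsymmx ->
  size (eigvals M) = n /\
  exists2 U : 'M[R[i]]_n, U \is unitarymx &
    U *m M *m U^t* = diag_mx (\row_a ((eigvals M)`_a)%:C%C).
Proof.
move=> Mh; set P := spectralmx M; set D := spectral_diag M.
have Pu : P \is unitarymx := spectral_unitarymx M.
have DP : P *m M *m P^t* = diag_mx D.
  have /orthomx_spectralP : M \is normalmx by apply: hermitian_normalmx.
  rewrite -/P -/D => {1}->; rewrite invmx_unitary //.
  by rewrite !mulmxA (unitarymxP Pu) mul1mx -mulmxA (unitarymxP Pu) mulmx1.
have Dr a : (complex.Re (D 0 a))%:C%C = D 0 a.
  by apply: RRe_real; apply: (mxOverP (hermitian_spectral_diag_real Mh)).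
have cM : \prod_(z <- char_roots M) ('X - z%:P) = \prod_(a < n) ('X - (D 0 a)%:P).
  rewrite /char_roots; case: closed_field_poly_normal => r /= Dr'.
  rewrite (monicP (char_poly_monic M)) scale1r in Dr'; rewrite -Dr'.
  rewrite -(char_poly_unitary_similar M Pu) DP char_poly_trig ?diag_mx_is_trig //.
  by apply: eq_bigr => a _; rewrite mxE eqxx.
have pM : perm_eq (char_roots M) [seq D 0 a | a <- enum 'I_n].
  by apply: prod_XsubC_eq; rewrite cM big_map big_enum.
have pE : perm_eq (eigvals M) [tuple complex.Re (D 0 a) | a < n].
  rewrite /eigvals perm_sort; apply: (perm_trans (perm_map _ pM)).
  by rewrite -map_comp.
have sz : size (eigvals M) = n by rewrite (perm_size pE) size_tuple.
split=> //; have /tuple_permP[s Es] := pE; exists (row_perm s P).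
  apply/unitarymxP/matrixP => a b; have /matrixP/(_ (s a) (s b)) := unitarymxP Pu.
  by rewrite !mxE (inj_eq perm_inj) => <-; apply: eq_bigr => k _; rewrite !mxE.
apply/matrixP => a b; have /matrixP/(_ (s a) (s b)) := DP.
rewrite !mxE (inj_eq perm_inj) -(Dr (s a)) Es (nth_map a) ?size_enum_ord //.
rewrite tnth_mktuple nth_ord_enum => <-; apply: eq_bigr => k _; rewrite !mxE.
by congr (_ * _); apply: eq_bigr => l _; rewrite !mxE.
Qed.

(** * Doubly stochastic matrices *)

Definition bistochastic (R : numDomainType) (n : nat) (S : 'M[R]_n) : Prop :=
  [/\ forall a b, 0 <= S a b, forall a, \sum_b S a b = 1
    & forall b, \sum_a S a b = 1].

Lemma sum_mx1 (R : pzSemiRingType) (n : nat) (x : 'I_n -> R) (a : 'I_n) :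
  \sum_b (1%:M : 'M[R]_n) a b * x b = x a.
Proof.
rewrite (bigD1 a) //= mxE eqxx mul1r big1 ?addr0 // => b ba.
by rewrite mxE eq_sym (negPf ba) mul0r.
Qed.

Lemma bistochastic1 (R : numDomainType) (n : nat) :
  bistochastic (1%:M : 'M[R]_n).
Proof.
have rowsum a : \sum_b (1%:M : 'M[R]_n) a b = 1.
  by rewrite -[RHS](sum_mx1 (fun=> 1) a); apply: eq_bigr => b _; rewrite mulr1.
split=> // [a b|b]; first by rewrite mxE ler0n.
by rewrite -[RHS](rowsum b); apply: eq_bigr => a _; rewrite !mxE eq_sym.
Qed.

(** The left side is the sum of the smallest values of lam, since t separates
    B from its complement.  On the right, lam b carries the weight
    w b = \sum_(a in A) S a b, which lies between 0 and 1 and has total mass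
    #|A| = #|B|.  The equality of masses allows lam to be replaced by lam - t,
    and then w b - (b \in B) and lam b - t have the same sign for every b. *)
Lemma bistochastic_sum_ge (R : realDomainType) (n : nat) (S : 'M[R]_n)
    (lam : 'I_n -> R) (A B : {set 'I_n}) (t : R) :
  bistochastic S -> #|A| = #|B| ->
  (forall b, b \in B -> lam b <= t) -> (forall b, b \notin B -> t <= lam b) ->
  \sum_(b in B) lam b <= \sum_(a in A) \sum_b S a b * lam b.
Proof.
move=> [S0 Sr Sc] cAB lamB lamNB; rewrite exchange_big /= -subr_ge0.
pose w b := \sum_(a in A) S a b.
have w0 b : 0 <= w b by apply: sumr_ge0.
have w1 b : w b <= 1.
  rewrite -(Sc b) [leRHS](bigID (mem A)) /= lerDl.
  exact: sumr_ge0.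
have -> : \sum_b \sum_(a in A) S a b * lam b - \sum_(b in B) lam b =
    \sum_b (w b - (b \in B)%:R) * (lam b - t).
  have -> : \sum_(b in B) lam b = \sum_b (b \in B)%:R * lam b.
    by rewrite big_mkcond; apply: eq_bigr => b _; case: (b \in B); rewrite ?mul1r ?mul0r.
  under [RHS]eq_bigr => b _ do rewrite mulrBr.
  rewrite [RHS]sumrB -mulr_suml (_ : \sum_b (w b - _) = 0) ?mul0r ?subr0; last first.
    rewrite sumrB exchange_big /= (eq_bigr (fun=> 1)) // sumr_const cAB.
    by rewrite -natr_sum -big_mkcond /= sum1_card subrr.
  rewrite -sumrB; apply: eq_bigr => b _.
  by rewrite mulrBl mulr_suml.
apply: sumr_ge0 => b _; case: (boolP (b \in B)) => bB.
  by rewrite mulr_le0 ?subr_le0 ?w1 ?lamB.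
by rewrite subr0 mulr_ge0 // subr_ge0 lamNB.
Qed.

Definition pairing (R : pzSemiRingType) (n : nat) (S : 'M[R]_n)
    (x y : 'I_n -> R) : R :=
  \sum_a \sum_b x a * S a b * y b.

Lemma pairing_tr (R : comPzSemiRingType) (n : nat) (S : 'M[R]_n)
    (x y : 'I_n -> R) :
  pairing S^T x y = pairing S y x.
Proof.
rewrite /pairing exchange_big /=; apply: eq_bigr => a _; apply: eq_bigr => b _.
by rewrite mxE mulrC [x b * _]mulrC mulrA.
Qed.

Lemma pairing1 (R : nzSemiRingType) (n : nat) (x : 'I_n -> R) :
  pairing 1%:M x x = \sum_a x a ^+ 2.
Proof.
rewrite /pairing; apply: eq_bigr => a _; rewrite expr2 -[X in _ * X](sum_mx1 x a).
by rewrite mulr_sumr; apply: eq_bigr => b _; rewrite mulrA.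
Qed.

Lemma pairing_ge0 (R : numDomainType) (n : nat) (S : 'M[R]_n)
    (x y : 'I_n -> R) :
  bistochastic S -> (forall a, 0 <= x a) -> (forall a, 0 <= y a) ->
  0 <= pairing S x y.
Proof.
move=> [S0 _ _] x0 y0; rewrite /pairing; apply: sumr_ge0 => a _; apply: sumr_ge0 => b _.
by rewrite !mulr_ge0.
Qed.

(** The bound x a * x b <= (x a ^+ 2 + x b ^+ 2) / 2, averaged with the
    weights S a b. *)
Lemma pairing_le (R : realFieldType) (n : nat) (S : 'M[R]_n) (x : 'I_n -> R) :
  bistochastic S -> pairing S x x <= \sum_a x a ^+ 2.
Proof.
move=> [S0 Sr Sc].
have -> : \sum_a x a ^+ 2 =
    \sum_a \sum_b (S a b * (x a ^+ 2 / 2) + S a b * (x b ^+ 2 / 2)).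
  under [RHS]eq_bigr => a _ do rewrite big_split /= -mulr_suml Sr mul1r.
  rewrite big_split /= exchange_big /=.
  under [X in _ = _ + X]eq_bigr => a _ do rewrite -mulr_suml Sc mul1r.
  by rewrite -big_split; apply: eq_bigr => a _ /=; field.
apply: ler_sum => a _; apply: ler_sum => b _.
rewrite -subr_ge0 (_ : _ - _ = S a b * ((x a - x b) ^+ 2 / 2)); last by field.
by rewrite mulr_ge0 // divr_ge0 ?sqr_ge0.
Qed.

(** * Eigenvalue inequalities from cancelling doubly stochastic averages *)

(** Here p and q are the positive and negative parts of lam.  In F p p the
    terms with i = j add up to d times the sum of the squares of p, and the
    other terms are nonnegative; in F q q all d ^ 2 terms are bounded by the
    sum of the squares of q. *)
Lemma positive_squares_le (R : realFieldType) (n d : nat)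
    (S : 'I_d -> 'I_d -> 'M[R]_n) (lam : 'I_n -> R) :
  (0 < d)%N ->
  (forall i j, bistochastic (S i j)) -> (forall i, S i i = 1%:M) ->
  (forall i j, S j i = (S i j)^T) ->
  (forall i a, \sum_j \sum_b S i j a b * lam b = 0) ->
  \sum_(a | 0 < lam a) lam a ^+ 2 <= d%:R * \sum_(a | lam a < 0) lam a ^+ 2.
Proof.
move=> d0 Sb S1 Str Slam.
pose p a := Num.max (lam a) 0; pose q a := Num.max (- lam a) 0.
have p0 a : 0 <= p a by rewrite le_max lexx orbT.
have q0 a : 0 <= q a by rewrite le_max lexx orbT.
have lamE a : lam a = p a - q a.
  by rewrite /p /q; case: (lerP (lam a) 0); case: (lerP (- lam a) 0); lra.
have -> : \sum_(a | 0 < lam a) lam a ^+ 2 = \sum_a p a ^+ 2.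
  rewrite big_mkcond; apply: eq_bigr => a _; rewrite /p.
  by case: (ltrP 0 (lam a)) => // _; rewrite expr0n.
have -> : \sum_(a | lam a < 0) lam a ^+ 2 = \sum_a q a ^+ 2.
  rewrite big_mkcond; apply: eq_bigr => a _; rewrite /q -oppr_gt0.
  by case: (ltrP 0 (- lam a)) => h; rewrite ?sqrrN // expr0n.
pose F x y := \sum_i \sum_j pairing (S i j) x y.
have FE x : F x p = F x q.
  apply/eqP; rewrite -subr_eq0 -sumrB; apply/eqP/big1 => i _.
  rewrite -sumrB /pairing.
  under eq_bigr => j _ do rewrite -sumrB.
  rewrite exchange_big /=; apply: big1 => a _.
  transitivity (x a * \sum_j \sum_b S i j a b * lam b); last by rewrite Slam mulr0.
  rewrite mulr_sumr; apply: eq_bigr => j _; rewrite -sumrB mulr_sumr.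
  by apply: eq_bigr => b _; rewrite lamE; ring.
have Fsym x y : F x y = F y x.
  rewrite /F exchange_big /=; apply: eq_bigr => i _; apply: eq_bigr => j _.
  by rewrite Str pairing_tr.
have Fpq : F p p = F q q by rewrite FE Fsym FE.
have lo : d%:R * \sum_a p a ^+ 2 <= F p p.
  rewrite mulr_natl -[X in _ *+ X]card_ord -sumr_const; apply: ler_sum => i _.
  rewrite (bigD1 i) //= S1 pairing1 lerDl; apply: sumr_ge0 => j _.
  exact: pairing_ge0.
have hi : F q q <= d%:R * (d%:R * \sum_a q a ^+ 2).
  rewrite !mulr_natl -[X in _ *+ X]card_ord -sumr_const; apply: ler_sum => i _.
  rewrite -[X in _ *+ X]card_ord -sumr_const; apply: ler_sum => j _.
  exact: pairing_le.
by rewrite -(ler_pM2l (x := d%:R)) ?ltr0n // (le_trans lo) // Fpq.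
Qed.

(** The values of lam on A are recovered from the term j = i, where S j is the
    identity; the other d - 1 terms are bounded by [bistochastic_sum_ge]. *)
Lemma top_sum_le_bottom (R : realFieldType) (n d : nat) (i : 'I_d)
    (S : 'I_d -> 'M[R]_n) (lam : 'I_n -> R) (A B : {set 'I_n}) (t : R) :
  (forall j, bistochastic (S j)) -> S i = 1%:M ->
  (forall a, \sum_j \sum_b S j a b * lam b = 0) ->
  #|A| = #|B| ->
  (forall b, b \in B -> lam b <= t) -> (forall b, b \notin B -> t <= lam b) ->
  \sum_(a in A) lam a <= (d%:R - 1) * - \sum_(b in B) lam b.
Proof.
move=> Sb Si Slam cAB lamB lamNB.
have A1 : \sum_(a in A) lam a = \sum_(a in A) \sum_b S i a b * lam b.
  by apply: eq_bigr => a _; rewrite Si sum_mx1.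
have -> : \sum_(a in A) lam a = - \sum_(j | j != i) \sum_(a in A) \sum_b S j a b * lam b.
  apply/eqP; rewrite -addr_eq0 A1; apply/eqP.
  transitivity (\sum_j \sum_(a in A) \sum_b S j a b * lam b).
    by rewrite [RHS](bigD1 i).
  by rewrite exchange_big big1.
have -> : d%:R - 1 = (#|[pred j : 'I_d | j != i]|)%:R :> R.
  rewrite -[in LHS](card_ord d) (cardD1 i) inE natrD addrAC subrr add0r.
  by congr _%:R; apply: eq_card => j; rewrite !inE andbT.
rewrite mulrN lerN2 mulr_natl -sumr_const; apply: ler_sum => j _.
exact: bistochastic_sum_ge lamNB.
Qed.

(** * From orthogonal representations to doubly stochastic matrices *)

Lemma trmxC_mul (F : numClosedFieldType) (m n p : nat)
    (A : 'M[F]_(m, n)) (B : 'M[F]_(n, p)) :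
  (A *m B)^t* = B^t* *m A^t*.
Proof. by rewrite trmx_mul map_mxM. Qed.

(** Unlike `|z| ^+ 2, whose type is R[i], this real number can be an entry of
    a doubly stochastic matrix over R. *)
Definition sqmod (R : realType) (z : R[i]) : R :=
  complex.Re z ^+ 2 + complex.Im z ^+ 2.

Lemma sqmodE (R : realType) (z : R[i]) : (sqmod z)%:C%C = z * z^*.
Proof. by rewrite add_Re2_Im2 normCK. Qed.

Lemma unitary_bistochastic (R : realType) (n : nat) (Q : 'M[R[i]]_n) :
  Q \is unitarymx -> bistochastic (map_mx (@sqmod R) Q).
Proof.
have rowsum (P : 'M[R[i]]_n) : P \is unitarymx ->
    forall a, \sum_b sqmod (P a b) = 1.
  move=> Pu a; apply: complexI; rewrite rmorph_sum rmorph1 /=.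
  have /matrixP/(_ a a) := unitarymxP Pu; rewrite !mxE eqxx => h.
  rewrite -[RHS]h.
  by apply: eq_bigr => b _; rewrite [LHS]sqmodE !mxE.
move=> Qu; split=> [a b|a|b]; first by rewrite mxE addr_ge0 // sqr_ge0.
  by rewrite -(rowsum Q Qu a); apply: eq_bigr => b _; rewrite mxE.
have QTu : Q^T \is unitarymx by rewrite trmx_unitary.
by rewrite -(rowsum _ QTu b); apply: eq_bigr => a _; rewrite !mxE.
Qed.

(** The matrices S i j are the squared moduli of Q i j = V i *m (V j)^t*, where
    V j = U *m D j and D j is the diagonal matrix of the j-th coordinates of
    the representation.  Orthogonality gives \sum_j (D j)^t* *m M *m D j = 0,
    hence \sum_j Q i j *m L *m (Q i j)^t* = 0 for the diagonal matrix L of the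
    eigenvalues; the last conclusion is the diagonal of this relation. *)
Lemma orth_rep_bistochastic (R : realType) (n d : nat) (e : rel 'I_n)
    (Psi : 'I_n -> 'cV[R[i]]_d) (M U : 'M[R[i]]_n) (lam : 'I_n -> R) :
  orth_rep e Psi -> normalized Psi ->
  (forall k l, ~~ e k l -> M k l = 0) ->
  U \is unitarymx -> U *m M *m U^t* = diag_mx (\row_a (lam a)%:C%C) ->
  exists S : 'I_d -> 'I_d -> 'M[R]_n,
    [/\ forall i j, bistochastic (S i j), forall i, S i i = 1%:M,
        forall i j, S j i = (S i j)^T
      & forall i a, \sum_j \sum_b S i j a b * lam b = 0].
Proof.
move=> Po Pn M0 Uu UM.
pose D j : 'M[R[i]]_n := diag_mx (\row_k Psi k j 0).
have DE j : (D j)^t* = diag_mx (\row_k (Psi k j 0)^*).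
  rewrite /D tr_diag_mx map_diag_mx; congr diag_mx.
  by apply/rowP => k; rewrite !mxE.
have Du j : D j \is unitarymx.
  apply/unitarymxP; rewrite DE mulmx_diag -diag_const_mx; congr diag_mx.
  by apply/rowP => k; rewrite !mxE -normCK Pn expr1n.
have DMD : \sum_j (D j)^t* *m M *m D j = 0.
  apply/matrixP => k l; rewrite summxE mxE.
  under eq_bigr => j _ do rewrite DE mul_mx_diag mul_diag_mx !mxE mulrAC.
  rewrite -mulr_suml; have [/Po|/M0 ->] := boolP (e k l); last by rewrite mulr0.
  move=> /matrixP/(_ 0 0); rewrite !mxE => h; rewrite -[RHS](mul0r (M k l)).
  by congr (_ * _); rewrite -[RHS]h; apply: eq_bigr => j _; rewrite !mxE.
pose V j := U *m D j; pose L : 'M[R[i]]_n := diag_mx (\row_a (lam a)%:C%C).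
have Vu j : V j \is unitarymx by rewrite mul_unitarymx.
have VLV : \sum_j (V j)^t* *m L *m V j = 0.
  rewrite -[RHS]DMD; apply: eq_bigr => j _.
  rewrite /L -UM /V trmxC_mul !mulmxA; congr (_ *m _).
  by rewrite !mulmxKtV.
pose Q i j := V i *m (V j)^t*.
have Qt i j : (Q i j)^t* = Q j i by rewrite /Q trmxC_mul trmxCK.
have QLQ i : \sum_j Q i j *m L *m (Q i j)^t* = 0.
  transitivity (V i *m (\sum_j (V j)^t* *m L *m V j) *m (V i)^t*); last first.
    by rewrite VLV mulmx0 mul0mx.
  rewrite mulmx_sumr mulmx_suml; apply: eq_bigr => j _.
  by rewrite Qt /Q !mulmxA.
have Qu i j : Q i j \is unitarymx by rewrite mul_unitarymx // trmxC_unitary.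
have Q1 i : Q i i = 1%:M by apply/unitarymxP.
clearbody Q; exists (fun i j => map_mx (@sqmod R) (Q i j)); split.
- by move=> i j; apply/unitary_bistochastic.
- move=> i; rewrite Q1; apply/matrixP => a b; apply: complexI.
  by rewrite !mxE [LHS]sqmodE; case: (a == b); rewrite ?rmorph0 ?rmorph1 ?mulr0 ?mulr1.
- move=> i j; apply/matrixP => a b; apply: complexI.
  by rewrite -Qt !mxE [LHS]sqmodE [RHS]sqmodE conjCK mulrC.
move=> i a; apply: complexI; rewrite rmorph0.
have /matrixP/(_ a a) := QLQ i; rewrite summxE mxE => <-.
rewrite rmorph_sum; apply: eq_bigr => j _.
rewrite mul_mx_diag rmorph_sum !mxE; apply: eq_bigr => b _.
by rewrite /= rmorphM !mxE /= mulrAC -sqmodE.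
Qed.

(** * The two spectral bounds *)

Lemma eigvals_antitone (R : realType) (n : nat) (M : 'M[R[i]]_n) (a b : nat) :
  (a <= b < size (eigvals M))%N -> (eigvals M)`_b <= (eigvals M)`_a.
Proof.
move=> /andP[ab bs]; have ge_tr : transitive (>=%R : rel R).
  by move=> y x z xy yz; exact: le_trans yz xy.
have srt : sorted >=%R (eigvals M).
  by apply: sort_sorted => x y; exact: le_total.
have ge_refl : reflexive (>=%R : rel R) by move=> x; exact: lexx.
apply: (sorted_leq_nth ge_tr ge_refl 0 srt) => //.
by rewrite inE (leq_ltn_trans ab).
Qed.

(** Write T and b for the sums of the m largest and of the m smallest
    eigenvalues, so that T <= (d - 1) (- b).  Together with b <= T this gives
    0 <= d (- b), so the denominator - b cannot be negative. *)
Lemma eig_ratio_le (R : realType) (n d : nat) (e : rel 'I_n)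
    (Psi : 'I_n -> 'cV[R[i]]_d) (M : 'M[R[i]]_n) (m : nat) :
  (0 < d)%N -> orth_rep e Psi -> normalized Psi ->
  M \is hermsymmx -> (forall k l, ~~ e k l -> M k l = 0) ->
  (0 < m < n)%N -> eig_ratio M m <= d%:R - 1.
Proof.
move=> d0 Po Pn Mh M0 /andP[m0 mn]; have [sz [U Uu UM]] := hermitian_eigvals Mh.
have [S [Sb S1 _ Slam]] := orth_rep_bistochastic Po Pn M0 Uu UM.
pose lam (a : 'I_n) := (eigvals M)`_a.
pose A := [set a : 'I_n | (a < m)%N]; pose B := [set b | rev_ord b \in A].
pose t := (eigvals M)`_(n - m).
have cAB : #|A| = #|B|.
  by rewrite (_ : B = @rev_ord n @^-1: A) ?card_preimset //; exact: rev_ord_inj.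
have lamB b : b \in B -> lam b <= t.
  rewrite !inE /= => bm; apply: eigvals_antitone; rewrite sz ltn_ord andbT.
  by have := ltn_ord b; lia.
have lamNB b : b \notin B -> t <= lam b.
  rewrite !inE /= => bm; apply: eigvals_antitone; rewrite sz.
  by have := ltn_ord b; lia.
have top : \sum_(1 <= i < m.+1) mu M i = \sum_(a in A) lam a.
  rewrite big_add1 big_mkord (big_ord_widen n (fun i => mu M i.+1)) 1?ltnW //.
  by apply: eq_bigl => a; rewrite inE.
have bot : \sum_(1 <= i < m.+1) mu M (n - i + 1) = \sum_(b in B) lam b.
  rewrite big_add1 big_mkord.
  rewrite (big_ord_widen n (fun i => mu M (n - i.+1 + 1))) 1?ltnW //.
  rewrite [RHS](reindex_inj rev_ord_inj) /=; apply: eq_big => [a|a _].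
    by rewrite !inE rev_ordK.
  by rewrite /mu addn1.
have d1 : 0 <= d%:R - 1 :> R by rewrite subr_ge0 ler1n.
pose i0 : 'I_d := Ordinal d0.
have le_top := top_sum_le_bottom (Sb i0) (S1 i0) (Slam i0) cAB lamB lamNB.
have le_bot : \sum_(b in B) lam b <= \sum_(a in A) lam a.
  apply: le_trans (bistochastic_sum_ge (bistochastic1 R n) cAB lamB lamNB) _.
  by under eq_bigr => a _ do rewrite sum_mx1.
rewrite /eig_ratio top bot; set T := \sum_(a in A) _ in le_top le_bot *.
set b := \sum_(b in B) _ in le_top le_bot *.
have dR : 0 < d%:R :> R by rewrite ltr0n.
have b0 : 0 <= - b by rewrite -(pmulr_rge0 _ dR); lra.
(* If the denominator is 0, the quotient is 0 by convention. *)
have [->|bN] := eqVneq (- b) 0; first by rewrite invr0 mulr0.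
by rewrite ler_pdivrMr // lt_def bN.
Qed.

Lemma Splus_ratio_le (R : realType) (n d : nat) (e : rel 'I_n)
    (Psi : 'I_n -> 'cV[R[i]]_d) (M : 'M[R[i]]_n) :
  (0 < d)%N -> orth_rep e Psi -> normalized Psi ->
  M \is hermsymmx -> (forall k l, ~~ e k l -> M k l = 0) ->
  Splus M / Sminus M <= d%:R.
Proof.
move=> d0 Po Pn Mh M0; have [sz [U Uu UM]] := hermitian_eigvals Mh.
have [S [Sb S1 St Slam]] := orth_rep_bistochastic Po Pn M0 Uu UM.
have := positive_squares_le d0 Sb S1 St Slam.
have sumE (P : pred R) : \sum_(x <- eigvals M | P x) x ^+ 2 =
    \sum_(a < n | P (eigvals M)`_a) (eigvals M)`_a ^+ 2.
  by rewrite (big_nth 0) big_mkord sz.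
rewrite -(sumE (fun x => 0 < x)) -(sumE (fun x => x < 0)) => le_pm.
rewrite -/(Splus M) -/(Sminus M) in le_pm.
have [->|mN] := eqVneq (Sminus M) 0; first by rewrite invr0 mulr0.
rewrite ler_pdivrMr // lt_def mN.
by apply: sumr_ge0 => x _; rewrite sqr_ge0.
Qed.

Theorem mainTheorem5 (R : realType) (n : nat) (e : rel 'I_n)
    (e_sym : symmetric e) (e_irr : irreflexive e)
    (e_edge : exists k l, e k l) :
  [/\ (norm_orth_rank R e_irr <= chromatic_number e_irr)%N,
      (forall W : 'M[R[i]]_n, W \is hermsymmx ->
        schurmx W (adjmx R e) != 0 ->
        1 + max_eig_ratio (schurmx W (adjmx R e))
          <= (norm_orth_rank R e_irr)%:R
        /\ Splus (schurmx W (adjmx R e)) / Sminus (schurmx W (adjmx R e))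
          <= (norm_orth_rank R e_irr)%:R)
    & [/\ (const_mx 1 : 'M[R[i]]_n) \is hermsymmx,
          schurmx (const_mx 1) (adjmx R e) = adjmx R e
        & adjmx R e != 0]].
Proof.
have [k [l ekl]] := e_edge.
have n1 : (1 < n)%N.
  have kl : k != l by apply: contraTneq ekl => ->; rewrite e_irr.
  by move: kl; rewrite -val_eqE /=; have := ltn_ord k; have := ltn_ord l; lia.
split; first by apply: norm_orth_rank_le_chromatic; exact: ltnW.
  move=> W Wh _; rewrite /norm_orth_rank.
  case: ex_minnP => d /andP[d0 /asboolP[Psi [Po Pn]]] _.
  set M := schurmx W (adjmx R e).
  have Mh : M \is hermsymmx.
    apply/is_hermitianmxP; rewrite expr0 scale1r; apply/matrixP => a b.
    have /is_hermitianmxP/matrixP/(_ a b) := Wh; rewrite expr0 scale1r !mxE => {1}->.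
    by rewrite rmorphM rmorph_nat e_sym.
  have M0 a b : ~~ e a b -> M a b = 0 by rewrite !mxE => /negPf->; rewrite mulr0.
  split; last exact: (Splus_ratio_le d0 Po Pn Mh M0).
  rewrite addrC -lerBrDr /max_eig_ratio.
  rewrite big_nat; apply: bigmax_le => [|m mn]; exact: (eig_ratio_le d0 Po Pn Mh M0).
split.
- apply/is_hermitianmxP; rewrite expr0 scale1r; apply/matrixP => a b.
  by rewrite !mxE rmorph1.
- by apply/matrixP => a b; rewrite !mxE mul1r.
by apply/eqP => /matrixP/(_ k l); rewrite !mxE ekl => /eqP; rewrite oner_eq0.
Qed.
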